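(* Assume the Framework and the Purification Postulate. Let $\Psi\in\mathfrak S_1(\mathrm A\tilde{\mathrm A})$ be a pure state that is dynamically faithful for $\mathrm A$, let $\tilde\omega:=(e_{\mathrm A}\otimes\mathcal I_{\tilde{\mathrm A}})\Psi$, and for $\mathcal C\in\mathfrak T(\mathrm A,\mathrm B)$ set $R_{\mathcal C}:=(\mathcal C\otimes\mathcal I_{\tilde{\mathrm A}})\Psi\in\mathfrak S(\mathrm B\tilde{\mathrm A})$. Then: (1) $\{\mathcal C_i\}_{i\in X}\mapsto\{R_{\mathcal C_i}\}_{i\in X}$ is a bijection between tests from $\mathrm A$ to $\mathrm B$ and preparation-tests $\{R_i\}_{i\in X}$ of $\mathrm B\tilde{\mathrm A}$ satisfying $\sum_{i\in X}(e_{\mathrm B}\otimes\mathcal I_{\tilde{\mathrm A}})R_i=\tilde\omega$; (2) $\mathcal C$ is atomic if and only if $R_{\mathcal C}$ is pure; (3) $\mathcal C\mapsto R_{\mathcal C}$ is a bijection between $\mathfrak T(\mathrm A,\mathrm B)$ and the set of states $R\in\mathfrak S(\mathrm B\tilde{\mathrm A})$ with $(e_{\mathrm B}\otimes\mathcal I_{\tilde{\mathrm A}})R\in D_{\tilde\omega}$.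
   Context: Framework. We work in an operational-probabilistic theory: there is a collection of systems $\mathrm A,\mathrm B,\dots$, closed under a composition $\mathrm A\mathrm B$ (associative, symmetric up to a reversible swap, with a trivial system $\mathrm I$ satisfying $\mathrm A\mathrm I=\mathrm A$); for each pair of systems a set $\mathfrak T(\mathrm A,\mathrm B)$ of transformations; a test from $\mathrm A$ to $\mathrm B$ is a finite collection $\{\mathcal C_i\}_{i\in X}\subseteq\mathfrak T(\mathrm A,\mathrm B)$, and every transformation belongs to some test. Tests are closed under sequential composition, parallel composition ($\otimes$), coarse-graining (summing outcomes over the blocks of a partition of $X$) and conditioning (choosing the next test depending on the outcome of the previous one). States of $\mathrm A$ are the elements of $\mathfrak S(\mathrm A):=\mathfrak T(\mathrm I,\mathrm A)$, effects are the elements of $\mathfrak T(\mathrm A,\mathrm I)$, and transformations $\mathrm I\to\mathrm I$ are probabilities in $[0,1]$ (those of a test sum to $1$; composition is multiplication). An effect $a$ and a state $\rho$ give the probability $(a|\rho)$. States (effects) are identified when they give equal probabilities on all effects (states); transformations $\mathcal C,\mathcal C'$ are identified when $\mathcal C\otimes\mathcal I_{\mathrm S}$ and $\mathcal C'\otimes\mathcal I_{\mathrm S}$ act identically on all states of $\mathrm A\mathrm S$ for every system $\mathrm S$. States span a finite-dimensional real vector space $\mathfrak S_{\mathbb R}(\mathrm A)$, transformations act linearly, and $\mathfrak T_{\mathbb R}(\mathrm A,\mathrm B)$ is the real span of $\mathfrak T(\mathrm A,\mathrm B)$. Standing assumptions: (i) causality: each system $\mathrm A$ has a unique deterministic effect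 $e_{\mathrm A}$ (the effect forming a one-outcome observation test), and $e_{\mathrm A\mathrm B}=e_{\mathrm A}\otimes e_{\mathrm B}$; (ii) local discriminability: if two states of $\mathrm A\mathrm B$ differ, some product effect $a\otimes b$ gives them different probabilities; (iii) all sets of states are closed, the theory is not deterministic (hence all sets of states, effects and transformations are convex), and perfectly distinguishable states exist. A state $\rho$ is normalized if $(e|\rho)=1$; $\mathfrak S_1(\mathrm A)$ is the set of normalized states. A channel is a $\mathcal C\in\mathfrak T(\mathrm A,\mathrm B)$ with $e_{\mathrm B}\circ\mathcal C=e_{\mathrm A}$. A channel $\mathcal U\in\mathfrak T(\mathrm A,\mathrm B)$ is reversible if some channel $\mathcal W\in\mathfrak T(\mathrm B,\mathrm A)$ satisfies $\mathcal W\mathcal U=\mathcal I_{\mathrm A}$, $\mathcal U\mathcal W=\mathcal I_{\mathrm B}$; $\mathbf G_{\mathrm A}$ is the group of reversible channels on $\mathrm A$. The marginal of a state $\sigma$ of $\mathrm A\mathrm B$ on $\mathrm A$ is $(\mathcal I_{\mathrm A}\otimes e_{\mathrm B})\sigma$. Refinement. For $\mathcal C\in\mathfrak T(\mathrm A,\mathrm B)$, write $\mathcal D\prec\mathcal C$ if there are a test $\{\mathcal D_j\}_{j\in Y}$ and $Y_0\subseteq Y$ with $\mathcal C=\sum_{j\in Y_0}\mathcal D_j$ and $\mathcal D\in\{\mathcal D_j\}_{j\in Y_0}$; the refinement set is $D_{\mathcal C}=\{\mathcal D:\mathcal D\prec\mathcal C\}$. $\mathcal C$ is atomic if $\mathcal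 D\prec\mathcal C$ implies $\mathcal D=\lambda\mathcal C$ for some $\lambda\in[0,1]$. A pure state is an atomic state; a state is mixed otherwise. A state $\omega$ of $\mathrm A$ is internal if $\mathrm{Span}(D_\omega)=\mathfrak S_{\mathbb R}(\mathrm A)$. Purification Postulate. For every $\rho\in\mathfrak S_1(\mathrm A)$ there are a system $\mathrm B$ and a pure $\Psi\in\mathfrak S_1(\mathrm A\mathrm B)$ with $(\mathcal I_{\mathrm A}\otimes e_{\mathrm B})\Psi=\rho$ (a purification of $\rho$, with purifying system $\mathrm B$); and if $\Psi,\Psi'\in\mathfrak S_1(\mathrm A\mathrm B)$ are purifications of the same state, then $\Psi'=(\mathcal I_{\mathrm A}\otimes\mathcal U)\Psi$ for some $\mathcal U\in\mathbf G_{\mathrm B}$. A state $\sigma\in\mathfrak S(\mathrm A\mathrm C)$ is dynamically faithful for system $\mathrm A$ if for every system $\mathrm B$ and every $\mathcal A,\mathcal A'\in\mathfrak T(\mathrm A,\mathrm B)$, $(\mathcal A\otimes\mathcal I_{\mathrm C})\sigma=(\mathcal A'\otimes\mathcal I_{\mathrm C})\sigma$ implies $\mathcal A=\mathcal A'$. A preparation-test of a system is a test from $\mathrm I$ to it. *)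

(* Defs.v *)
From Stdlib Require Import Reals List Permutation.
Import ListNotations.
Open Scope R_scope.

Set Implicit Arguments.
Unset Strict Implicit.

(*  - Tr A B       : the real span T_R(A,B) of the transformations A -> B    *)
(*                   (elements are already identified, so Leibniz equality    *)
(*                   is the paper's identification); tz/tadd/tsc are its      *)
(*                   vector-space operations.                                *)
(*  - isTest t     : the list t (indexed by its positions, a finite outcome  *)
(*                   set X) is a test.                                       *)
Record OPTdata := {
  Sys : Type;
  sI : Sys;
  cmp : Sys -> Sys -> Sys;
  cmpA : forall A B C, cmp A (cmp B C) = cmp (cmp A B) C;
  cmpI_r : forall A, cmp A sI = A;
  cmpI_l : forall A, cmp sI A = A;
  Tr : Sys -> Sys -> Type;
  tz : forall A B, Tr A B;
  tadd : forall A B, Tr A B -> Tr A B -> Tr A B;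
  tsc : forall A B, R -> Tr A B -> Tr A B;
  seqc : forall A B C, Tr B C -> Tr A B -> Tr A C;
  tid : forall A, Tr A A;
  par : forall A B C D, Tr A B -> Tr C D -> Tr (cmp A C) (cmp B D);
  swap : forall A B, Tr (cmp A B) (cmp B A);
  toR : Tr sI sI -> R;
  isTest : forall A B, list (Tr A B) -> Prop;
  eff : forall A, Tr A sI
}.

Arguments Sys : clear implicits.
Arguments Tr : clear implicits.
Arguments sI {o}.
Arguments cmp {o}.
Arguments cmpA {o}.
Arguments cmpI_r {o}.
Arguments cmpI_l {o}.
Arguments tz {o A B}.
Arguments tadd {o A B}.
Arguments tsc {o A B}.
Arguments seqc {o A B C}.
Arguments tid {o}.
Arguments par {o A B C D}.
Arguments swap {o}.
Arguments toR {o}.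
Arguments isTest {o A B}.
Arguments eff {o}.

Section Derived.
Variable T : OPTdata.

Definition castT {A A' B B' : Sys T} (eA : A = A') (eB : B = B') (x : Tr T A B)
  : Tr T A' B' :=
  match eA in _ = A0, eB in _ = B0 return Tr T A0 B0 with
  | eq_refl, eq_refl => x
  end.

Definition tsum {A B : Sys T} (l : list (Tr T A B)) : Tr T A B :=
  fold_right tadd tz l.

Definition isT {A B : Sys T} (C : Tr T A B) : Prop :=
  exists t, isTest t /\ In C t.

Definition sel {X : Type} (t : list X) (m : list bool) : list X :=
  map fst (filter snd (combine t m)).

Definition refines {A B : Sys T} (D C : Tr T A B) : Prop :=
  exists (t : list (Tr T A B)) (m : list bool),
    isTest t /\ length m = length t /\ C = tsum (sel t m) /\ In D (sel t m).

Definition atomic {A B : Sys T} (C : Tr T A B) : Prop :=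
  forall D, refines D C -> exists l : R, 0 <= l <= 1 /\ D = tsc l C.

Definition isState {A : Sys T} (rho : Tr T sI A) : Prop := isT rho.
Definition normalized {A : Sys T} (rho : Tr T sI A) : Prop :=
  isT rho /\ toR (seqc (eff A) rho) = 1.
Definition pure {A : Sys T} (rho : Tr T sI A) : Prop := isT rho /\ atomic rho.

Definition marg1 {A B : Sys T} (sigma : Tr T sI (cmp A B)) : Tr T sI A :=
  seqc (castT eq_refl (cmpI_r A) (par (tid A) (eff B))) sigma.
Definition marg2 {A B : Sys T} (sigma : Tr T sI (cmp A B)) : Tr T sI B :=
  seqc (castT eq_refl (cmpI_l B) (par (eff A) (tid B))) sigma.

Definition channel {A B : Sys T} (C : Tr T A B) : Prop :=
  isT C /\ seqc (eff B) C = eff A.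

Definition reversible {A B : Sys T} (U : Tr T A B) : Prop :=
  channel U /\ exists W : Tr T B A,
    channel W /\ seqc W U = tid A /\ seqc U W = tid B.

Definition dynFaithful {A C : Sys T} (sigma : Tr T sI (cmp A C)) : Prop :=
  forall (B : Sys T) (C1 C2 : Tr T A B), isT C1 -> isT C2 ->
    seqc (par C1 (tid C)) sigma = seqc (par C2 (tid C)) sigma -> C1 = C2.

Definition choi {A At B : Sys T} (Psi : Tr T sI (cmp A At)) (C : Tr T A B)
  : Tr T sI (cmp B At) :=
  seqc (par C (tid At)) Psi.

Definition Purification : Prop :=
  (forall (A : Sys T) (rho : Tr T sI A), normalized rho ->
     exists (B : Sys T) (Psi : Tr T sI (cmp A B)),
       normalized Psi /\ pure Psi /\ marg1 Psi = rho) /\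
  (forall (A B : Sys T) (Psi Psi' : Tr T sI (cmp A B)),
     normalized Psi -> normalized Psi' -> pure Psi -> pure Psi' ->
     marg1 Psi = marg1 Psi' ->
     exists U : Tr T B B, reversible U /\ Psi' = seqc (par (tid A) U) Psi).

End Derived.

Arguments castT {T A A' B B'}.
Arguments tsum {T A B}.
Arguments isT {T A B}.
Arguments refines {T A B}.
Arguments atomic {T A B}.
Arguments isState {T A}.
Arguments normalized {T A}.
Arguments pure {T A}.
Arguments marg1 {T A B}.
Arguments marg2 {T A B}.
Arguments channel {T A B}.
Arguments reversible {T A B}.
Arguments dynFaithful {T A C}.
Arguments choi {T A At B}.

Definition bij_on {X Y : Type} (P : X -> Prop) (Q : Y -> Prop) (f : X -> Y) : Prop :=
  (forall x, P x -> Q (f x)) /\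
  (forall x y, P x -> P y -> f x = f y -> x = y) /\
  (forall y, Q y -> exists x, P x /\ f x = y).

Record Framework (T : OPTdata) : Prop := {
  fw_add_comm : forall A B (x y : Tr T A B), tadd x y = tadd y x;
  fw_add_assoc : forall A B (x y z : Tr T A B), tadd x (tadd y z) = tadd (tadd x y) z;
  fw_add_0 : forall A B (x : Tr T A B), tadd x tz = x;
  fw_add_opp : forall A B (x : Tr T A B), tadd x (tsc (-1) x) = tz;
  fw_sc_1 : forall A B (x : Tr T A B), tsc 1 x = x;
  fw_sc_mul : forall A B a b (x : Tr T A B), tsc a (tsc b x) = tsc (a * b) x;
  fw_sc_addr : forall A B a b (x : Tr T A B), tsc (a + b) x = tadd (tsc a x) (tsc b x);
  fw_sc_addv : forall A B a (x y : Tr T A B), tsc a (tadd x y) = tadd (tsc a x) (tsc a y);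
  fw_span : forall A B (x : Tr T A B), exists l : list (R * Tr T A B),
      Forall (fun p => isT (snd p)) l /\
      x = tsum (map (fun p => tsc (fst p) (snd p)) l);
  fw_findim : forall A, exists basis : list (Tr T sI A), forall x : Tr T sI A,
      exists cs : list R, length cs = length basis /\
        x = tsum (map (fun p => tsc (fst p) (snd p)) (combine cs basis));
  fw_seq_assoc : forall A B C D (x : Tr T C D) (y : Tr T B C) (z : Tr T A B),
      seqc x (seqc y z) = seqc (seqc x y) z;
  fw_seq_idl : forall A B (x : Tr T A B), seqc (tid B) x = x;
  fw_seq_idr : forall A B (x : Tr T A B), seqc x (tid A) = x;
  fw_seq_addl : forall A B C (x y : Tr T B C) (z : Tr T A B),
      seqc (tadd x y) z = tadd (seqc x z) (seqc y z);
  fw_seq_addr : forall A B C (x : Tr T B C) (y z : Tr T A B),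
      seqc x (tadd y z) = tadd (seqc x y) (seqc x z);
  fw_seq_scl : forall A B C a (x : Tr T B C) (y : Tr T A B),
      seqc (tsc a x) y = tsc a (seqc x y);
  fw_seq_scr : forall A B C a (x : Tr T B C) (y : Tr T A B),
      seqc x (tsc a y) = tsc a (seqc x y);
  fw_par_addl : forall A B C D (x y : Tr T A B) (z : Tr T C D),
      par (tadd x y) z = tadd (par x z) (par y z);
  fw_par_addr : forall A B C D (x : Tr T A B) (y z : Tr T C D),
      par x (tadd y z) = tadd (par x y) (par x z);
  fw_par_scl : forall A B C D a (x : Tr T A B) (y : Tr T C D),
      par (tsc a x) y = tsc a (par x y);
  fw_par_scr : forall A B C D a (x : Tr T A B) (y : Tr T C D),
      par x (tsc a y) = tsc a (par x y);
  fw_par_seq : forall A B C A' B' C' (x : Tr T B C) (y : Tr T A B)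
                      (x' : Tr T B' C') (y' : Tr T A' B'),
      seqc (par x x') (par y y') = par (seqc x y) (seqc x' y');
  fw_par_id : forall A B : Sys T, par (tid A) (tid B) = tid (cmp A B);
  fw_par_assoc : forall A1 B1 A2 B2 A3 B3 (x : Tr T A1 B1) (y : Tr T A2 B2)
                        (z : Tr T A3 B3),
      castT (cmpA A1 A2 A3) (cmpA B1 B2 B3) (par x (par y z)) = par (par x y) z;
  fw_par_unitr : forall A B (x : Tr T A B),
      castT (cmpI_r A) (cmpI_r B) (par x (tid sI)) = x;
  fw_par_unitl : forall A B (x : Tr T A B),
      castT (cmpI_l A) (cmpI_l B) (par (tid sI) x) = x;
  fw_swap_inv : forall A B : Sys T, seqc (swap B A) (swap A B) = tid (cmp A B);
  fw_swap_nat : forall A B C D (x : Tr T A B) (y : Tr T C D),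
      seqc (swap B D) (par x y) = seqc (par y x) (swap A C);
  fw_swap_test : forall A B : Sys T, isTest [swap A B];
  fw_toR_inj : forall p q : Tr T sI sI, toR p = toR q -> p = q;
  fw_toR_add : forall p q : Tr T sI sI, toR (tadd p q) = toR p + toR q;
  fw_toR_sc : forall a (p : Tr T sI sI), toR (tsc a p) = a * toR p;
  fw_toR_id : toR (tid (@sI T)) = 1;
  fw_toR_seq : forall p q : Tr T sI sI, toR (seqc p q) = toR p * toR q;
  fw_prob_nonneg : forall p : Tr T sI sI, isT p -> 0 <= toR p;
  fw_prob_sum : forall p : list (Tr T sI sI), isTest p ->
      fold_right Rplus 0 (map toR p) = 1;
  fw_test_id : forall A : Sys T, isTest [tid A];
  fw_test_seq : forall A B C (t : list (Tr T A B)) (u : list (Tr T B C)),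
      isTest t -> isTest u ->
      isTest (flat_map (fun D => map (fun C0 => seqc D C0) t) u);
  fw_test_par : forall A B C D (t : list (Tr T A B)) (u : list (Tr T C D)),
      isTest t -> isTest u ->
      isTest (flat_map (fun C0 => map (fun D0 => par C0 D0) u) t);
  fw_test_perm : forall A B (t u : list (Tr T A B)),
      Permutation t u -> isTest t -> isTest u;
  fw_test_merge : forall A B (C D : Tr T A B) (t : list (Tr T A B)),
      isTest (C :: D :: t) -> isTest (tadd C D :: t);
  fw_test_cond : forall A B C (t : list (Tr T A B)) (us : list (list (Tr T B C))),
      isTest t -> length us = length t -> Forall isTest us ->
      isTest (flat_map (fun p => map (fun D => seqc D (fst p)) (snd p))
                       (combine t us));
  fw_state_sep : forall A (rho sigma : Tr T sI A), isT rho -> isT sigma ->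
      (forall a : Tr T A sI, isT a -> seqc a rho = seqc a sigma) -> rho = sigma;
  fw_effect_sep : forall A (a b : Tr T A sI), isT a -> isT b ->
      (forall rho : Tr T sI A, isT rho -> seqc a rho = seqc b rho) -> a = b;
  fw_trans_sep : forall A B (C D : Tr T A B), isT C -> isT D ->
      (forall S (rho : Tr T sI (cmp A S)), isT rho ->
         seqc (par C (tid S)) rho = seqc (par D (tid S)) rho) -> C = D;
  fw_eff_test : forall A : Sys T, isTest [eff A];
  fw_eff_unique : forall A (e : Tr T A sI), isTest [e] -> e = eff A;
  fw_eff_cmp : forall A B : Sys T,
      eff (cmp A B) = castT eq_refl (cmpI_r sI) (par (eff A) (eff B));
  fw_local_discr : forall A B (rho sigma : Tr T sI (cmp A B)), isT rho -> isT sigma ->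
      rho <> sigma ->
      exists (a : Tr T A sI) (b : Tr T B sI), isT a /\ isT b /\
        seqc (castT eq_refl (cmpI_r sI) (par a b)) rho <>
        seqc (castT eq_refl (cmpI_r sI) (par a b)) sigma;
  (* (iii) closed state sets (w.r.t. the finite-dimensional topology,
     expressed through convergence of all probabilities) *)
  fw_closed : forall A (rho : nat -> Tr T sI A) (x : Tr T sI A),
      (forall n, isT (rho n)) ->
      (forall a : Tr T A sI, isT a ->
         Un_cv (fun n => toR (seqc a (rho n))) (toR (seqc a x))) ->
      isT x;
  fw_nondet : exists p : Tr T sI sI, isT p /\ 0 < toR p < 1;
  fw_convex : forall A B (x y : Tr T A B) l, isT x -> isT y -> 0 <= l <= 1 ->
      isT (tadd (tsc l x) (tsc (1 - l) y));
  fw_perf_dist : exists (A : Sys T) (r1 r2 : Tr T sI A) (a1 a2 : Tr T A sI),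
      normalized r1 /\ normalized r2 /\ isTest [a1; a2] /\
      toR (seqc a1 r1) = 1 /\ toR (seqc a2 r2) = 1 /\
      toR (seqc a1 r2) = 0 /\ toR (seqc a2 r1) = 0
}.

(* Main.v *)
(** A preparation-test [R_i] of [B At] with total marginal [omega~] is lifted
    to a test [A -> B] as follows.  With [phi_i] perfectly distinguished by
    [c_i], purify [sum_i R_i (x) phi_i]; this purifies the same state of [At]
    as [Psi], so by uniqueness of purification it is [V Psi] for a channel
    [V] on [A], and the [i]-th transformation is "[V], then discard the
    purifying system and apply [c_i]".  Parts (2) and (3) follow because any
    list of states whose probabilities sum to 1 is a preparation-test, which
    allows refinements of [R_C] (resp. a state [R] as in (3)) to be completed
    to tests covered by (1). *)
Require Import Defs.
From Stdlib Require Import Reals List Permutation Lra Lia ProofIrrelevance ClassicalEpsilon.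
From Corelib Require Import ssreflect.
Import ListNotations.
Open Scope R_scope.

Set Implicit Arguments.
Unset Strict Implicit.

(** The framework only says that each state belongs to some test. Turning arbitrary states of total
    probability 1 into a test rests on writing every state as a probability times a normalised
    state. Here closedness of the state sets enters, since the normalised state is a limit of
    repeat-until-success procedures. Coins of every bias come from convexity and perfect
    distinguishability, and conditioning on them does the rest. The uniqueness clause of
    purification compares states with one and the same purifying system and acts on the right
    factor. [Psi] has a different purifying system from the new state, and it sits on the left, so
    both are padded with pure states and swapped. Padding keeps purity because local
    discriminability makes products of pure states pure. *)

Section Theory.
Variable T : OPTdata.
Hypothesis HF : Framework T.

Notation Hom := (Tr T).
Notation St A := (Tr T sI A).

(** * Cast-free monoidal calculus *)

(* Arrows with their endpoints bundled: on [mor] the associativity and unit laws hold without [castT]. *)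
Record mor := Mor { mdom : Sys T; mcod : Sys T; marr : Hom mdom mcod }.

(* Composition of mismatched arrows is junk ([x]). *)
Definition mcomp (x y : mor) : mor :=
  match excluded_middle_informative (mcod y = mdom x) with
  | left e => Mor (seqc (marr x) (castT eq_refl e (marr y)))
  | right _ => x
  end.
Definition mtens (x y : mor) : mor := Mor (par (marr x) (marr y)).
Definition mid (A : Sys T) : mor := Mor (tid A).
Definition mscale (a : R) (x : mor) : mor := Mor (tsc a (marr x)).
Arguments mcomp : simpl never.

(** The field is dependent, so the equality is first transported along the endpoint equalities,
    which proof irrelevance then collapses to [eq_refl]. *)
Lemma Mor_inj A B (x y : Hom A B) : Mor x = Mor y -> x = y.
Proof.
have H (m1 m2 : mor) : m1 = m2 -> forall (e1 : mdom m1 = mdom m2)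
    (e2 : mcod m1 = mcod m2), castT e1 e2 (marr m1) = marr m2.
  move=> -> e1 e2.
  by rewrite (proof_irrelevance _ e1 eq_refl) (proof_irrelevance _ e2 eq_refl).
by move=> /H /(_ eq_refl eq_refl).
Qed.

Lemma Mor_cast A A' B B' (e1 : A = A') (e2 : B = B') (x : Hom A B) :
  Mor (castT e1 e2 x) = Mor x.
Proof. by destruct e1, e2. Qed.

Lemma Mor_seqc A B C (x : Hom B C) (y : Hom A B) :
  Mor (seqc x y) = mcomp (Mor x) (Mor y).
Proof.
rewrite /mcomp; case: excluded_middle_informative => [e|[]//].
by rewrite (proof_irrelevance _ e eq_refl).
Qed.

Lemma Mor_par A B C D (x : Hom A B) (y : Hom C D) :
  Mor (par x y) = mtens (Mor x) (Mor y).
Proof. by []. Qed.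

Lemma Mor_tid A : Mor (tid A) = mid A. Proof. by []. Qed.

Lemma Mor_tsc a A B (x : Hom A B) : Mor (tsc a x) = mscale a (Mor x).
Proof. by []. Qed.

Lemma mcod_comp x y : mcod (mcomp x y) = mcod x.
Proof. by rewrite /mcomp; case: excluded_middle_informative. Qed.

Lemma mdom_comp x y : mcod y = mdom x -> mdom (mcomp x y) = mdom y.
Proof. by rewrite /mcomp; case: excluded_middle_informative. Qed.

Lemma mcompA x y z : mcod z = mdom y -> mcod y = mdom x ->
  mcomp x (mcomp y z) = mcomp (mcomp x y) z.
Proof.
destruct x, y, z; simpl => ? ?; subst.
by rewrite -!Mor_seqc (fw_seq_assoc HF).
Qed.

Lemma mcomp_idl A x : mcod x = A -> mcomp (mid A) x = x.
Proof. by destruct x => /= <-; rewrite -Mor_seqc (fw_seq_idl HF). Qed.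

Lemma mcomp_idr A x : mdom x = A -> mcomp x (mid A) = x.
Proof. by destruct x => /= <-; rewrite -Mor_seqc (fw_seq_idr HF). Qed.

Lemma mtens_comp x x' y y' : mcod y = mdom x -> mcod y' = mdom x' ->
  mcomp (mtens x x') (mtens y y') = mtens (mcomp x y) (mcomp x' y').
Proof.
destruct x, y, x', y'; simpl => ? ?; subst.
by rewrite -!Mor_seqc /mtens /= (fw_par_seq HF).
Qed.

Lemma mtensA x y z : mtens x (mtens y z) = mtens (mtens x y) z.
Proof.
destruct x as [A1 B1 x], y as [A2 B2 y], z as [A3 B3 z].
rewrite -!Mor_par -(Mor_cast (cmpA A1 A2 A3) (cmpA B1 B2 B3)).
by rewrite (fw_par_assoc HF).
Qed.

Lemma mtens1 x : mtens x (mid sI) = x.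
Proof.
destruct x as [A B x].
by rewrite -Mor_par -(Mor_cast (cmpI_r A) (cmpI_r B)) (fw_par_unitr HF).
Qed.

Lemma m1tens x : mtens (mid sI) x = x.
Proof.
destruct x as [A B x].
by rewrite -Mor_par -(Mor_cast (cmpI_l A) (cmpI_l B)) (fw_par_unitl HF).
Qed.

Lemma mid_cmp A B : mtens (mid A) (mid B) = mid (cmp A B).
Proof. by rewrite /mid -(fw_par_id HF). Qed.

Lemma mtens_scalel a x y : mtens (mscale a x) y = mscale a (mtens x y).
Proof. by rewrite /mtens /mscale /= (fw_par_scl HF). Qed.

Lemma mtens_scaler a x y : mtens x (mscale a y) = mscale a (mtens x y).
Proof. by rewrite /mtens /mscale /= (fw_par_scr HF). Qed.

Lemma Mor_scalar (p : Hom sI sI) : Mor p = mscale (toR p) (mid sI).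
Proof.
rewrite /mscale; f_equal; apply: (fw_toR_inj HF).
by rewrite (fw_toR_sc HF) (fw_toR_id HF); lra.
Qed.

(** [sysd] discharges the endpoint conditions of the laws on [mor]; [tomor] moves an equation of
    typed arrows to [mor], where casts disappear. *)
Ltac sysd := repeat first
  [ reflexivity | assumption
  | progress simpl
  | rewrite mcod_comp | rewrite cmpA | rewrite cmpI_l | rewrite cmpI_r
  | (rewrite mdom_comp; [ solve [sysd] | ]) ].
Ltac tomor := apply Mor_inj;
  rewrite ?(Mor_cast, Mor_seqc, Mor_par, Mor_tid, Mor_tsc).

Lemma mid_tens_comp A x y : mcod y = mdom x ->
  mtens (mid A) (mcomp x y) = mcomp (mtens (mid A) x) (mtens (mid A) y).
Proof. by move=> H; rewrite mtens_comp // mcomp_idl. Qed.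

(** * Linear structure and finite sums *)

Lemma tadd_0l A B (x : Hom A B) : tadd tz x = x.
Proof. by rewrite (fw_add_comm HF) (fw_add_0 HF). Qed.

Lemma tsc0 A B (x : Hom A B) : tsc 0 x = tz.
Proof.
rewrite -(fw_add_opp HF x) -{2}(fw_sc_1 HF x) -(fw_sc_addr HF).
by congr tsc; lra.
Qed.

Lemma tadd_cancel_l A B (x y z : Hom A B) : tadd x y = tadd x z -> y = z.
Proof.
move=> H.
have E (w : Hom A B) : w = tadd (tadd x w) (tsc (-1) x).
  by rewrite (fw_add_comm HF x w) -(fw_add_assoc HF) (fw_add_opp HF) (fw_add_0 HF).
by rewrite (E y) (E z) H.
Qed.

Lemma tsc_tz A B a : tsc a (@tz T A B) = tz.
Proof. by rewrite -(tsc0 tz) (fw_sc_mul HF); congr tsc; lra. Qed.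

Lemma seqc_tz A B C (x : Hom B C) : seqc x (@tz T A B) = tz.
Proof. by rewrite -(tsc0 tz) (fw_seq_scr HF) tsc0. Qed.

Lemma tz_seqc A B C (x : Hom A B) : seqc (@tz T B C) x = tz.
Proof. by rewrite -(tsc0 tz) (fw_seq_scl HF) tsc0. Qed.

Lemma tz_par A B C D (x : Hom C D) : par (@tz T A B) x = tz.
Proof. by rewrite -(tsc0 tz) (fw_par_scl HF) tsc0. Qed.

Lemma toR_tz : toR (@tz T sI sI) = 0.
Proof. by rewrite -(tsc0 tz) (fw_toR_sc HF); lra. Qed.

Lemma tsum_app A B (l l' : list (Hom A B)) :
  tsum (l ++ l') = tadd (tsum l) (tsum l').
Proof.
by elim: l => [|x l /= ->]; rewrite /= ?tadd_0l // (fw_add_assoc HF).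
Qed.

Lemma tsum_perm A B (l l' : list (Hom A B)) : Permutation l l' -> tsum l = tsum l'.
Proof.
induction 1 as [|x l1 l2 _ IH|x y l1|l1 l2 l3 _ IH1 _ IH2] => //=.
- by rewrite IH.
- by rewrite !(fw_add_assoc HF) (fw_add_comm HF y).
- by rewrite IH1.
Qed.

Lemma seqc_tsum A B C (x : Hom B C) (l : list (Hom A B)) :
  seqc x (tsum l) = tsum (map (seqc x) l).
Proof. by elim: l => [|y l IH] /=; rewrite ?seqc_tz // (fw_seq_addr HF) IH. Qed.

Lemma tsum_seqc A B C (l : list (Hom B C)) (x : Hom A B) :
  seqc (tsum l) x = tsum (map (fun y => seqc y x) l).
Proof. by elim: l => [|y l IH] /=; rewrite ?tz_seqc // (fw_seq_addl HF) IH. Qed.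

Lemma tsum_par A B C D (l : list (Hom A B)) (x : Hom C D) :
  par (tsum l) x = tsum (map (fun y => par y x) l).
Proof. by elim: l => [|y l IH] /=; rewrite ?tz_par // (fw_par_addl HF) IH. Qed.

Lemma toR_tsum (l : list (Hom sI sI)) :
  toR (tsum l) = fold_right Rplus 0 (map toR l).
Proof. by elim: l => [|y l IH] /=; rewrite ?toR_tz // (fw_toR_add HF) IH. Qed.

(** * Closure properties of tests and transformations *)

Lemma test_seq1 A B C (D : Hom B C) (t : list (Hom A B)) :
  isTest [D] -> isTest t -> isTest (map (seqc D) t).
Proof. by move=> HD Ht; have := fw_test_seq HF Ht HD; rewrite /= app_nil_r. Qed.

Lemma test_1seq A B C (D : Hom A B) (u : list (Hom B C)) :
  isTest [D] -> isTest u -> isTest (map (fun x => seqc x D) u).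
Proof.
move=> HD Hu; have := fw_test_seq HF HD Hu.
have -> // : flat_map (fun D0 => map (fun C0 => seqc D0 C0) [D]) u
  = map (fun x => seqc x D) u by clear; elim: u => //= ? ? ->.
Qed.

Lemma test_par1 A B C D (t : list (Hom A B)) (x : Hom C D) :
  isTest t -> isTest [x] -> isTest (map (fun y => par y x) t).
Proof.
move=> Ht Hx; have := fw_test_par HF Ht Hx.
have -> // : flat_map (fun C0 => map (fun D0 => par C0 D0) [x]) t
  = map (fun y => par y x) t by clear; elim: t => //= ? ? ->.
Qed.

Lemma test_1par A B C D (t : list (Hom A B)) (x : Hom C D) :
  isTest [x] -> isTest t -> isTest (map (par x) t).
Proof. by move=> Hx Ht; have := fw_test_par HF Hx Ht; rewrite /= app_nil_r. Qed.

Lemma test_cast A A' B B' (e1 : A = A') (e2 : B = B') (t : list (Hom A B)) :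
  isTest t -> isTest (map (castT e1 e2) t).
Proof. by destruct e1, e2; rewrite map_id. Qed.

(** Coarse-graining is given only for the two leading outcomes; iterating it merges an initial block
    and, with permutations, any block. *)
Lemma test_tsum_app A B (u : list (Hom A B)) (x : Hom A B) t :
  isTest (x :: t ++ u) -> isTest (tsum (x :: t) :: u).
Proof.
elim: t x => [|y t IH] x /= H; first by rewrite (fw_add_0 HF).
by rewrite (fw_add_assoc HF); apply: IH; apply: (fw_test_merge HF).
Qed.

Lemma test_tsum A B (t : list (Hom A B)) : t <> [] -> isTest t -> isTest [tsum t].
Proof.
case: t => // x t _ H; apply: (test_tsum_app (u := [])); by rewrite app_nil_r.
Qed.

Lemma isT_test A B (x : Hom A B) : isT x -> exists l, isTest (x :: l).
Proof.
move=> [t [Ht Hx]]; have [l1 [l2 E]] := in_split _ _ Hx; exists (l1 ++ l2).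
by apply: (fw_test_perm HF _ Ht); rewrite E; symmetry; apply: Permutation_middle.
Qed.

Lemma test_isT A B (x : Hom A B) t : isTest t -> In x t -> isT x.
Proof. by exists t. Qed.

Lemma test1_isT A B (x : Hom A B) : isTest [x] -> isT x.
Proof. by move=> H; apply: (test_isT H); left. Qed.

Lemma isT_seqc A B C (x : Hom B C) (y : Hom A B) : isT x -> isT y -> isT (seqc x y).
Proof.
move=> /isT_test [l Hx] /isT_test [l' Hy].
by apply: (test_isT (fw_test_seq HF Hy Hx)); left.
Qed.

Lemma isT_par A B C D (x : Hom A B) (y : Hom C D) : isT x -> isT y -> isT (par x y).
Proof.
move=> /isT_test [l Hx] /isT_test [l' Hy].
by apply: (test_isT (fw_test_par HF Hx Hy)); left.
Qed.

Lemma isT_cast A A' B B' (e1 : A = A') (e2 : B = B') (x : Hom A B) :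
  isT x -> isT (castT e1 e2 x).
Proof. by destruct e1, e2. Qed.

Lemma isT_tid (A : Sys T) : isT (tid A).
Proof. exact: test1_isT (fw_test_id HF A). Qed.

Lemma isT_eff (A : Sys T) : isT (eff A).
Proof. exact: test1_isT (fw_eff_test HF A). Qed.

Lemma eff_sI : eff sI = tid (@sI T).
Proof. by rewrite -(fw_eff_unique HF (fw_test_id HF sI)). Qed.

Lemma eff_seqc A B (x : Hom A B) : isTest [x] -> seqc (eff B) x = eff A.
Proof.
by move=> Hx; apply: (fw_eff_unique HF); apply: (test_seq1 (fw_eff_test HF B) Hx).
Qed.

Lemma prep_neq_nil A (t : list (St A)) : isTest t -> t <> [].
Proof.
move=> Ht E; move: Ht; rewrite E => /(test_seq1 (fw_eff_test HF A)) /(fw_prob_sum HF) /=; lra.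
Qed.

(** All other outcomes of a test containing [a] are merged into [a']. The first alternative is a
    test without other outcomes, where causality identifies [a]. *)
Lemma effect_compl A (a : Hom A sI) : isT a ->
  a = eff A \/ exists a', isT a' /\ tadd a a' = eff A /\ isTest [a; a'].
Proof.
move=> /isT_test [[|b l] Ht]; first by left; apply: (fw_eff_unique HF).
right; exists (tsum (b :: l)).
have Ht' : isTest [a; tsum (b :: l)].
  apply: (fw_test_perm HF (perm_swap _ _ _)); apply: test_tsum_app.
  by apply: (fw_test_perm HF _ Ht); apply: (Permutation_cons_append (b :: l)).
split; first by apply: (test_isT Ht'); right; left.
split=> //; apply: (fw_eff_unique HF); exact: (fw_test_merge HF Ht').
Qed.

(** * Probabilities of states and deterministic transformations *)

Definition prob A (rho : St A) : R := toR (seqc (eff A) rho).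

Lemma prob_ge0 A (rho : St A) : isT rho -> 0 <= prob rho.
Proof. by move=> H; apply: (fw_prob_nonneg HF); apply: isT_seqc => //; apply: isT_eff. Qed.

Lemma prob_add A (x y : St A) : prob (tadd x y) = prob x + prob y.
Proof. by rewrite /prob (fw_seq_addr HF) (fw_toR_add HF). Qed.

Lemma prob_tsc A a (x : St A) : prob (tsc a x) = a * prob x.
Proof. by rewrite /prob (fw_seq_scr HF) (fw_toR_sc HF). Qed.

Lemma prob_tsum A (l : list (St A)) : prob (tsum l) = fold_right Rplus 0 (map (@prob A) l).
Proof. by rewrite /prob seqc_tsum toR_tsum map_map. Qed.

Lemma prob_test1 A (x : St A) : isTest [x] -> prob x = 1.
Proof. by move=> H; rewrite /prob eff_seqc // eff_sI (fw_toR_id HF). Qed.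

Lemma prob_effect_le A (a : Hom A sI) (x : St A) : isT a -> isT x ->
  0 <= toR (seqc a x) <= prob x.
Proof.
move=> Ha Hx; split; first by apply: (fw_prob_nonneg HF); apply: isT_seqc.
rewrite /prob; case: (effect_compl Ha) => [->|[a' [Ha' [<- _]]]]; first by lra.
rewrite (fw_seq_addl HF) (fw_toR_add HF).
have := fw_prob_nonneg HF (isT_seqc Ha' Hx); lra.
Qed.

(** Impossibility has to be realised by a test: [a1] never occurs on [r2]. Mixing zero with the
    identity then gives every scalar in the unit interval. *)
Lemma isT_zero_scalar : isT (@tz T sI sI).
Proof.
have [A [r1 [r2 [a1 [a2 [_ [[H2 _] [Ha [_ [_ [H0 _]]]]]]]]]]] := fw_perf_dist HF.
have -> : tz = seqc a1 r2 by apply: (fw_toR_inj HF); rewrite toR_tz.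
by apply: isT_seqc => //; apply: (test_isT Ha); left.
Qed.

Lemma isT_scalar p : 0 <= p <= 1 -> isT (tsc p (tid (@sI T))).
Proof.
move=> Hp; have := fw_convex HF (isT_tid sI) isT_zero_scalar Hp.
by rewrite tsc_tz (fw_add_0 HF).
Qed.

Lemma isT_scale A B (x : Hom A B) p : isT x -> 0 <= p <= 1 -> isT (tsc p x).
Proof.
move=> Hx Hp.
have -> : tsc p x = castT (cmpI_r A) (cmpI_r B) (par x (tsc p (tid sI))).
  by tomor; rewrite mtens_scaler mtens1.
by apply: isT_cast; apply: isT_par => //; apply: isT_scalar.
Qed.

Lemma isT_tz A B (x : Hom A B) : isT x -> isT (@tz T A B).
Proof. by move=> Hx; rewrite -(tsc0 x); apply: isT_scale => //; lra. Qed.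

Lemma prob_eq0 A (x : St A) : isT x -> prob x = 0 -> x = tz.
Proof.
move=> Hx H0; apply: (fw_state_sep HF) => //; first exact: isT_tz Hx.
move=> a Ha; rewrite seqc_tz; apply: (fw_toR_inj HF); rewrite toR_tz.
have := prob_effect_le Ha Hx; lra.
Qed.

Lemma par_eff_cmp A B S (x : Hom A B) (rho : St (cmp A S)) :
  seqc (eff (cmp B S)) (seqc (par x (tid S)) rho) =
  seqc (castT eq_refl (cmpI_r sI) (par (seqc (eff B) x) (eff S))) rho.
Proof.
rewrite (fw_eff_cmp HF); tomor.
rewrite mcompA; try sysd.
by rewrite mtens_comp ?mcomp_idr.
Qed.

(** Extended states separate transformations. On each of them the output probability depends on [x]
    only through [seqc (eff B) x], so it vanishes, and a state of probability zero is zero. *)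
Lemma eff_eq0 A B (x : Hom A B) : isT x -> seqc (eff B) x = tz -> x = tz.
Proof.
move=> Hx H0; apply: (fw_trans_sep HF) => // [|S rho Hr]; first exact: isT_tz Hx.
rewrite tz_par tz_seqc; apply: prob_eq0.
  by apply: isT_seqc => //; apply: isT_par => //; apply: isT_tid.
rewrite /prob par_eff_cmp H0 tz_par.
have -> : castT eq_refl (cmpI_r sI) (@tz T (cmp A S) (cmp sI sI)) = tz.
  by move: (cmpI_r sI) => e; destruct e.
by rewrite tz_seqc toR_tz.
Qed.

(** The other outcomes of a test containing [C] merge into one that the deterministic effect sees as
    zero, hence is zero; absorbing it leaves [C] alone. *)
Lemma channel_test A B (C : Hom A B) : channel C -> isTest [C].
Proof.
move=> [/isT_test [[//|D l] Ht] HC].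
have Ht' : isTest [C; tsum (D :: l)].
  apply: (fw_test_perm HF (perm_swap _ _ _)); apply: test_tsum_app.
  by apply: (fw_test_perm HF _ Ht); apply: (Permutation_cons_append (D :: l)).
have HX : isT (tsum (D :: l)) by apply: (test_isT Ht'); right; left.
have E := fw_test_merge HF Ht'.
suff X0 : tsum (D :: l) = tz by rewrite X0 (fw_add_0 HF) in E.
apply: eff_eq0 => //; apply: (tadd_cancel_l (x := eff A)).
by rewrite (fw_add_0 HF) -{1}HC -(fw_seq_addr HF) eff_seqc.
Qed.

Lemma prob_test A (x : St A) : isT x -> prob x = 1 -> isTest [x].
Proof.
move=> Hx H; apply: channel_test; split=> //; apply: (fw_toR_inj HF).
by rewrite eff_sI (fw_toR_id HF).
Qed.

(** * Coins, normalisation and preparation-tests *)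

Lemma test_zero_one : isTest [@tz T sI sI; tid sI].
Proof.
have [A [r1 [r2 [a1 [a2 [_ [[H2 H2'] [Ha [_ [H1 [H0 _]]]]]]]]]]] := fw_perf_dist HF.
have := test_1seq (prob_test H2 H2') Ha => /=.
have -> : seqc a1 r2 = tz by apply: (fw_toR_inj HF); rewrite toR_tz.
by have -> : seqc a2 r2 = tid sI by apply: (fw_toR_inj HF); rewrite (fw_toR_id HF).
Qed.

(** Merging the other outcomes of a test containing the scalar [p] leaves one scalar, which must be
    [1 - p]. If [p] stands alone, then [p = 1] and [test_zero_one] supplies the zero outcome. *)
Lemma bernoulli_test p : 0 <= p <= 1 ->
  isTest [tsc p (tid (@sI T)); tsc (1 - p) (tid sI)].
Proof.
move=> Hp; have [[|q l] Ht] := isT_test (isT_scalar Hp).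
  have := fw_prob_sum HF Ht; rewrite /= (fw_toR_sc HF) (fw_toR_id HF) => Hp1.
  have -> : p = 1 by lra.
  have -> : 1 - 1 = 0 by lra.
  rewrite tsc0 (fw_sc_1 HF); exact: (fw_test_perm HF (perm_swap _ _ _) test_zero_one).
have Ht' : isTest [tsc p (tid sI); tsum (q :: l)].
  apply: (fw_test_perm HF (perm_swap _ _ _)); apply: test_tsum_app.
  by apply: (fw_test_perm HF _ Ht); apply: (Permutation_cons_append (q :: l)).
have -> // : tsc (1 - p) (tid sI) = tsum (q :: l).
apply: (fw_toR_inj HF); have := fw_prob_sum HF Ht'; rewrite /= !(fw_toR_sc HF) (fw_toR_id HF).
lra.
Qed.

Lemma flat_map_tid A B (l : list (Hom A B)) :
  flat_map (fun p => map (fun D => seqc D (fst p)) (snd p))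
    (combine l (repeat [tid B] (length l))) = l.
Proof. by elim: l => //= x l ->; rewrite (fw_seq_idl HF). Qed.

(** Induction by conditioning: a coin splits an outcome of weight [p + q] in two, and the identity
    follows all other outcomes. *)
Lemma distribution_test p (ps : list R) : 0 <= p -> Forall (Rle 0) ps ->
  p + fold_right Rplus 0 ps = 1 ->
  isTest (map (fun q => tsc q (tid (@sI T))) (p :: ps)).
Proof.
elim: ps p => [|q ps IH] p Hp Hps /= Hs.
  have -> : p = 1 by lra.
  by rewrite (fw_sc_1 HF); apply: (fw_test_id HF).
inversion_clear Hps as [|? ? Hq Hps'].
have /= Ht := IH (p + q) ltac:(lra) Hps' ltac:(lra).
have {Ht} Hsplit r : 0 <= r <= 1 ->
    isTest (tsc (r * (p + q)) (tid (@sI T)) :: tsc ((1 - r) * (p + q)) (tid sI) ::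
            map (fun q => tsc q (tid sI)) ps).
  move=> Hr; move: Ht; set l := map _ ps => Ht.
  have := @fw_test_cond _ HF _ _ _ _
    ([tsc r (tid sI); tsc (1 - r) (tid sI)] :: repeat [tid sI] (length l)) Ht.
  rewrite /= flat_map_tid !(fw_seq_scl HF) !(fw_seq_idl HF) !(fw_sc_mul HF).
  apply; first by rewrite repeat_length.
  constructor; first exact: bernoulli_test.
  by apply/Forall_forall => y Hy; rewrite (repeat_spec _ _ _ Hy); apply: (fw_test_id HF).
(* The bias should be [p / (p + q)]; when the denominator vanishes both weights are zero and any
   coin works. *)
have [E|E] := Req_dec (p + q) 0.
  have := Hsplit 0 ltac:(lra); rewrite E !Rmult_0_r.
  have -> : p = 0 by lra.
  by have -> : q = 0 by lra.
have pq : p + q > 0 by lra.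
have := Hsplit (p / (p + q)).
have -> : p / (p + q) * (p + q) = p by field.
have -> : (1 - p / (p + q)) * (p + q) = q by field.
apply; split; first by apply: Rle_mult_inv_pos.
by apply: (Rmult_le_reg_r (p + q)) => //; rewrite /Rdiv Rmult_assoc Rinv_l //; lra.
Qed.

Lemma scalar_state A (x : St A) (p : Hom sI sI) : seqc x p = tsc (toR p) x.
Proof.
have -> : p = tsc (toR p) (tid sI).
  by apply: (fw_toR_inj HF); rewrite (fw_toR_sc HF) (fw_toR_id HF); lra.
by rewrite (fw_seq_scr HF) (fw_seq_idr HF) (fw_toR_sc HF) (fw_toR_id HF) Rmult_1_r.
Qed.

Lemma Un_cv_geom p : 0 < p <= 1 -> Un_cv (fun n => (1 - p) ^ n) 0.
Proof.
move=> Hp e He.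
have [|N HN] := @pow_lt_1_zero (1 - p) _ e He.
  by rewrite Rabs_pos_eq; lra.
by exists N => n Hn; rewrite /R_dist Rminus_0_r; apply: HN.
Qed.

(* Repeat-until-success: preparing [x] again after each failure, at most [n]
   times, yields [(1 + (1-p) + ... + (1-p)^(n-1)) x] with [p = prob x]; these
   states converge to [x / p]. *)
Lemma renormalize A (x : St A) : isT x -> 0 < prob x -> isTest [tsc (/ prob x) x].
Proof.
move=> Hx; set p := prob x => p0.
have [[|y l] Ht] := isT_test Hx.
  have -> : p = 1 by exact: prob_test1.
  by rewrite Rinv_1 (fw_sc_1 HF).
have {}Ht : isTest [x; tsum (y :: l)].
  apply: (fw_test_perm HF (perm_swap _ _ _)); apply: test_tsum_app.
  by apply: (fw_test_perm HF _ Ht); apply: (Permutation_cons_append (y :: l)).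
set z := tsum _ in Ht.
have Hp1 : prob z = 1 - p.
  by have := prob_test1 (fw_test_merge HF Ht); rewrite prob_add -/p; lra.
have p1 : p <= 1.
  have Hz : isT z by apply: (test_isT Ht); right; left.
  by have := prob_ge0 Hz; lra.
pose s n := (1 - (1 - p) ^ n) / p.
have Hs n : isT (tsc (s n) x).
  elim: n => [|n IH].
    by rewrite /s /= Rminus_diag /Rdiv Rmult_0_l tsc0; apply: isT_tz Hx.
  (* After the outcome [x] nothing is done; after failure the output is discarded and the state of
     stage [n] is prepared. Merging these two branches gives stage [n + 1]. *)
  have [u Hu] := isT_test (isT_seqc IH (isT_eff A)).
  have Hc := @fw_test_cond _ HF _ _ _ _
    [[tid A]; seqc (tsc (s n) x) (eff A) :: u] Ht eq_refl.
  have {}Hc := Hc (Forall_cons _ (fw_test_id HF A) (Forall_cons _ Hu (Forall_nil _))).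
  move: Hc; rewrite /= => /(fw_test_merge HF) Hc.
  have := test_isT Hc (or_introl eq_refl).
  rewrite (fw_seq_idl HF) -(fw_seq_assoc HF) scalar_state -/(prob z) Hp1 (fw_sc_mul HF).
  rewrite -{1}(fw_sc_1 HF x) -(fw_sc_addr HF).
  have -> // : 1 + (1 - p) * s n = s (S n) by rewrite /s /=; field; lra.
apply: prob_test; last by rewrite prob_tsc -/p; field; lra.
apply: (fw_closed HF Hs) => a Ha e He.
set c := toR (seqc a x).
(* The error at stage [n] is [(1 - p) ^ n * Rabs c / p]; the added 1 keeps the denominator positive
   when [c = 0]. *)
have [N HN] := @Un_cv_geom p (conj p0 p1) (e * p / (Rabs c + 1))
  ltac:(apply: Rdiv_lt_0_compat; [nra | have := Rabs_pos c; lra]).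
exists N => n Hn; move: {HN} (HN n Hn).
rewrite /R_dist Rminus_0_r !(fw_seq_scr HF) !(fw_toR_sc HF) -/c /s => HN.
have -> : (1 - (1 - p) ^ n) / p * c - / p * c = - (((1 - p) ^ n) * c * / p) by field; lra.
rewrite Rabs_Ropp !Rabs_mult (Rabs_pos_eq (/ p)); first by apply: Rlt_le; apply: Rinv_0_lt_compat.
apply: (Rmult_lt_reg_r p) => //; rewrite Rmult_assoc Rinv_l; first lra.
have c0 := Rabs_pos c.
have : Rabs ((1 - p) ^ n) * (Rabs c + 1) < e * p.
  apply: (Rmult_lt_reg_r (/ (Rabs c + 1))); first by apply: Rinv_0_lt_compat; lra.
  by rewrite Rmult_assoc Rinv_r; lra.
have := Rabs_pos ((1 - p) ^ n); nra.
Qed.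

(** The zero state cannot be normalised; there the total of any test containing it serves as [b]. *)
Lemma deterministic_part A (x : St A) : isT x ->
  exists b, isTest [b] /\ x = tsc (prob x) b.
Proof.
move=> Hx; have [Hp|H0] := Rle_lt_or_eq _ _ (prob_ge0 Hx).
  exists (tsc (/ prob x) x); split; first exact: renormalize.
  by rewrite (fw_sc_mul HF) Rinv_r ?(fw_sc_1 HF) //; lra.
have [l Hl] := isT_test Hx; exists (tsum (x :: l)); split; first by apply: test_tsum.
by rewrite -H0 tsc0; apply: prob_eq0.
Qed.

(** Each state is a weight times a normalised state: draw an index with these weights, then prepare
    the normalised state of that index. *)
Lemma preparation_test A (xs : list (St A)) : Forall isT xs ->
  fold_right Rplus 0 (map (@prob A) xs) = 1 -> isTest xs.
Proof.
move=> Hxs.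
have [qs [-> [Hq ->]]] : exists qs : list (R * St A),
    xs = map (fun q => tsc (fst q) (snd q)) qs /\
    Forall (fun q => 0 <= fst q /\ isTest [snd q]) qs /\
    map (@prob A) xs = map fst qs.
  elim: Hxs => [|x l Hx _ [qs [E1 [H E2]]]]; first by exists [].
  have [b [Hb E]] := deterministic_part Hx.
  exists ((prob x, b) :: qs); rewrite /= -E -E1 -E2; do !split=> //.
  by constructor=> //; split=> //; apply: prob_ge0.
move=> H1.
have Hd : isTest (map (fun q => tsc q (tid (@sI T))) (map fst qs)).
  case: qs Hq H1 => [|q qs] /= Hq H1; first lra.
  inversion_clear Hq; apply: distribution_test => //; first by tauto.
  by apply/Forall_map; apply: Forall_impl H0 => ? [].
have := @fw_test_cond _ HF _ _ _ _ (map (fun q => [snd q]) qs) Hd.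
rewrite !length_map => /(_ eq_refl) Hc.
have {Hc} : isTest _ := Hc (proj2 (Forall_map _ _ _) (Forall_impl _ (fun q => @proj2 _ _) Hq)).
rewrite map_map.
have -> // : flat_map (fun p => map (fun D => seqc D (fst p)) (snd p))
    (combine (map (fun q => tsc (fst q) (tid sI)) qs) (map (fun q => [snd q]) qs)) =
  map (fun q => tsc (fst q) (snd q)) qs.
clear -HF; elim: qs => //= q qs ->.
by rewrite (fw_seq_scr HF) (fw_seq_idr HF).
Qed.

Lemma prob_le1 A (x : St A) : isT x -> prob x <= 1.
Proof.
move=> Hx; have [l Hl] := isT_test Hx.
have := prob_test1 (test_tsum (t := x :: l) ltac:(by []) Hl).
rewrite prob_tsum /=; suff : 0 <= fold_right Rplus 0 (map (@prob A) l) by lra.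
have : forall y, In y l -> isT y by move=> y Hy; apply: (test_isT Hl); right.
clear -HF; elim: l => [|y l IH] /= H; first lra.
have := prob_ge0 (H y (or_introl eq_refl)); have := IH (fun z Hz => H z (or_intror Hz)); lra.
Qed.

Lemma summands_test A (x y : St A) : isT x -> isT y -> prob x + prob y <= 1 ->
  exists z, isTest [x; y; z].
Proof.
move=> Hx Hy H1; have [b [Hb _]] := deterministic_part Hx.
exists (tsc (1 - (prob x + prob y)) b); apply: preparation_test.
  do !constructor=> //; apply: isT_scale; first exact: test1_isT.
  by have := prob_ge0 Hx; have := prob_ge0 Hy; lra.
by rewrite /= prob_tsc (prob_test1 Hb); lra.
Qed.

Lemma isT_tadd A (x y : St A) : isT x -> isT y -> prob x + prob y <= 1 ->
  isT (tadd x y).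
Proof.
move=> Hx Hy /(summands_test Hx Hy) [z /(fw_test_merge HF) Ht].
by apply: (test_isT Ht); left.
Qed.

(** * Refinements as initial blocks of tests *)

Lemma sel_perm X (t : list X) m : length m = length t ->
  Permutation t (sel t m ++ sel t (map negb m)).
Proof.
elim: t m => [|x t IH] [|b m] //= [/IH H]; rewrite /sel /=.
case: b => /=; first by constructor.
by etransitivity; [constructor; exact: H | apply: Permutation_middle].
Qed.

Lemma sel_prefix X (l1 l2 : list X) :
  sel (l1 ++ l2) (repeat true (length l1) ++ repeat false (length l2)) = l1.
Proof.
rewrite /sel; elim: l1 => [|x l1 /= ->] //=.
by elim: l2.
Qed.

Lemma refinesP A B (D C : Hom A B) :
  refines D C <-> exists l1 l2, isTest (D :: l1 ++ l2) /\ C = tsum (D :: l1).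
Proof.
split=> [[t [m [Ht [Hm [-> HD]]]]]|[l1 [l2 [Ht ->]]]].
  have [l1 [l2 E]] := in_split _ _ HD.
  have Hp : Permutation (sel t m) (D :: l1 ++ l2).
    by rewrite E; symmetry; apply: Permutation_middle.
  exists (l1 ++ l2), (sel t (map negb m)); split; last exact: tsum_perm.
  apply: (fw_test_perm HF _ Ht); etransitivity; first exact: (sel_perm Hm).
  exact: (Permutation_app_tail (sel t (map negb m)) Hp).
exists ((D :: l1) ++ l2), (repeat true (length (D :: l1)) ++ repeat false (length l2)).
rewrite sel_prefix !length_app !repeat_length; do !split=> //.
by left.
Qed.

Lemma refines_isT A B (D C : Hom A B) : refines D C -> isT D.
Proof. by move=> /refinesP [l1 [l2 [Ht _]]]; apply: (test_isT Ht); left. Qed.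

Lemma refines_seqc A B C (F : Hom B C) (D E : Hom A B) : isTest [F] ->
  refines D E -> refines (seqc F D) (seqc F E).
Proof.
move=> HFt /refinesP [l1 [l2 [Ht ->]]]; apply/refinesP.
exists (map (seqc F) l1), (map (seqc F) l2); split; last exact: seqc_tsum.
by rewrite -map_app; apply: (test_seq1 HFt Ht).
Qed.

Lemma refines_tadd A (D X : St A) : isT D -> isT X -> isT (tadd D X) ->
  refines D (tadd D X).
Proof.
move=> HD HX HC; apply/refinesP.
have [|z Hz] := summands_test HD HX; first by rewrite -prob_add; apply: prob_le1.
by exists [X], [z]; rewrite /= (fw_add_0 HF).
Qed.

Lemma refines_state A (D C : St A) : refines D C ->
  isT C /\ exists X, isT X /\ C = tadd D X.
Proof.
move=> /refinesP [l1 [l2 [Ht ->]]]; split.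
  by apply: (test_isT (test_tsum_app (t := l1) Ht)); left.
exists (tsum l1); split=> //; case: l1 Ht => [|x l1] Ht.
  by apply: isT_tz; apply: (test_isT Ht); left.
have Hp : Permutation (D :: (x :: l1) ++ l2) (x :: l1 ++ D :: l2).
  exact: (Permutation_middle (x :: l1) l2 D).
by apply: (test_isT (test_tsum_app (fw_test_perm HF Hp Ht))); left.
Qed.

Lemma normalized_test A (x : St A) : normalized x <-> isTest [x].
Proof.
split=> [[Hx Hp]|Hx]; first exact: prob_test.
by split; [exact: test1_isT | exact: prob_test1].
Qed.

(** * Product states, local effects and purity *)

Definition prodst X Y (x : St X) (y : St Y) : St (cmp X Y) :=
  castT (cmpI_r sI) eq_refl (par x y).
Definition prodeff X Y (a : Hom X sI) (b : Hom Y sI) : Hom (cmp X Y) sI :=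
  castT eq_refl (cmpI_r sI) (par a b).
(** [effR] and [effL] measure one factor and keep the other; at the deterministic effect they are
    the maps behind [marg1] and [marg2]. *)
Definition effR X Y (b : Hom Y sI) : Hom (cmp X Y) X :=
  castT eq_refl (cmpI_r X) (par (tid X) b).
Definition effL X Y (a : Hom X sI) : Hom (cmp X Y) Y :=
  castT eq_refl (cmpI_l Y) (par a (tid Y)).
Arguments effR X {Y} b.
Arguments effL {X} Y a.

Lemma eff_cmp X Y : eff (cmp X Y) = prodeff (eff X) (eff Y).
Proof. exact: fw_eff_cmp HF X Y. Qed.

Lemma effR_prodst X Y (b : Hom Y sI) (x : St X) (y : St Y) :
  seqc (effR X b) (prodst x y) = tsc (toR (seqc b y)) x.
Proof.
tomor; rewrite mtens_comp // mcomp_idl // -Mor_seqc Mor_scalar.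
by rewrite mtens_scaler mtens1.
Qed.

Lemma effL_prodst X Y (a : Hom X sI) (x : St X) (y : St Y) :
  seqc (effL Y a) (prodst x y) = tsc (toR (seqc a x)) y.
Proof.
tomor; rewrite mtens_comp // mcomp_idl // -Mor_seqc Mor_scalar.
by rewrite mtens_scalel m1tens.
Qed.

Lemma prodeff_effR X Y (a : Hom X sI) (b : Hom Y sI) :
  prodeff a b = seqc a (effR X b).
Proof.
tomor; rewrite -{2}(mtens1 (Mor a)) mtens_comp // mcomp_idr // mcomp_idl //.
Qed.

Lemma prodeff_effL X Y (a : Hom X sI) (b : Hom Y sI) :
  prodeff a b = seqc b (effL Y a).
Proof.
tomor; rewrite -{2}(m1tens (Mor b)) mtens_comp // mcomp_idr // mcomp_idl //.
Qed.

Lemma prodeff_prodst X Y (a : Hom X sI) (b : Hom Y sI) (x : St X) (y : St Y) :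
  toR (seqc (prodeff a b) (prodst x y)) = toR (seqc a x) * toR (seqc b y).
Proof.
by rewrite prodeff_effR -(fw_seq_assoc HF) effR_prodst (fw_seq_scr HF) (fw_toR_sc HF) Rmult_comm.
Qed.

Lemma prob_prodst X Y (x : St X) (y : St Y) : prob (prodst x y) = prob x * prob y.
Proof. by rewrite /prob eff_cmp; apply: prodeff_prodst. Qed.

Lemma isT_prodst X Y (x : St X) (y : St Y) : isT x -> isT y -> isT (prodst x y).
Proof. by move=> Hx Hy; apply: isT_cast; apply: isT_par. Qed.

Lemma test_effR X Y (l : list (Hom Y sI)) : isTest l -> isTest (map (effR X) l).
Proof.
move=> Hl; have := test_cast eq_refl (cmpI_r X) (test_1par (fw_test_id HF X) Hl).
by rewrite map_map.
Qed.

Lemma test_effL X Y (l : list (Hom X sI)) : isTest l -> isTest (map (effL Y) l).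
Proof.
move=> Hl; have := test_cast eq_refl (cmpI_l Y) (test_par1 Hl (fw_test_id HF Y)).
by rewrite map_map.
Qed.

Lemma isT_effR X Y (b : Hom Y sI) : isT b -> isT (effR X b).
Proof. by move=> Hb; apply: isT_cast; apply: isT_par => //; apply: isT_tid. Qed.

Lemma isT_effL X Y (a : Hom X sI) : isT a -> isT (effL Y a).
Proof. by move=> Ha; apply: isT_cast; apply: isT_par => //; apply: isT_tid. Qed.

Lemma prob_effL X Y (x : St (cmp X Y)) : prob (seqc (effL Y (eff X)) x) = prob x.
Proof. by rewrite /prob (fw_seq_assoc HF) -prodeff_effL -eff_cmp. Qed.

Lemma effR_tadd X Y (a b : Hom Y sI) : effR X (tadd a b) = tadd (effR X a) (effR X b).
Proof. by rewrite /effR (fw_par_addr HF); move: (cmpI_r X) => e; destruct e. Qed.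

Lemma effL_tadd X Y (a b : Hom X sI) : effL Y (tadd a b) = tadd (effL Y a) (effL Y b).
Proof. by rewrite /effL (fw_par_addl HF); move: (cmpI_l Y) => e; destruct e. Qed.

(** The remainders add up to a state because their total probability is at most that of [z]. *)
Lemma state_le_trans A (x y z : St A) :
  isT z -> isT x -> (exists u, isT u /\ y = tadd x u) -> (exists v, isT v /\ z = tadd y v) ->
  exists w, isT w /\ z = tadd x w.
Proof.
move=> Hz Hx [u [Hu ->]] [v [Hv E]]; exists (tadd u v).
rewrite E (fw_add_assoc HF); split=> //; apply: isT_tadd => //.
have := prob_le1 Hz; have := prob_ge0 Hx; rewrite E !prob_add; lra.
Qed.

(* Local effects on one factor refine the marginal, so purity of the factors
   forces every product effect to see [s] as a multiple of [prodst x y]. *)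
Lemma prodst_atomic X Y (x : St X) (y : St Y) : isTest [x] -> isTest [y] ->
  atomic x -> atomic y -> atomic (prodst x y).
Proof.
move=> Hx Hy Ax Ay s /[dup] /refines_isT Hs Hr.
have HR (b : Hom Y sI) : isT b -> exists l, seqc (effR X b) s = tsc l x.
  move=> Hb; suff [l [_ E]] : exists l, 0 <= l <= 1 /\ seqc (effR X b) s = tsc l x by exists l.
  apply: Ax.
  have Ht := test_effR X (fw_eff_test HF Y).
  have := refines_seqc Ht Hr.
  rewrite effR_prodst -/(prob y) (prob_test1 Hy) (fw_sc_1 HF) => /refines_state [_ Hle].
  have Hbs := isT_seqc (isT_effR X Hb) Hs.
  have [w [Hw E]] : exists w, isT w /\ x = tadd (seqc (effR X b) s) w.
    case: (effect_compl Hb) => [->//|[b' [Hb' [Eb _]]]].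
    apply: state_le_trans Hle => //; first exact: test1_isT.
    exists (seqc (effR X b') s); split; first by apply: isT_seqc => //; apply: isT_effR.
    by rewrite -(fw_seq_addl HF) -effR_tadd Eb.
  by rewrite E; apply: refines_tadd => //; rewrite -E; apply: test1_isT.
have HL (a : Hom X sI) : isT a -> exists l, seqc (effL Y a) s = tsc l y.
  move=> Ha; suff [l [_ E]] : exists l, 0 <= l <= 1 /\ seqc (effL Y a) s = tsc l y by exists l.
  apply: Ay.
  have Ht := test_effL Y (fw_eff_test HF X).
  have := refines_seqc Ht Hr.
  rewrite effL_prodst -/(prob x) (prob_test1 Hx) (fw_sc_1 HF) => /refines_state [_ Hle].
  have Has := isT_seqc (isT_effL Y Ha) Hs.
  have [w [Hw E]] : exists w, isT w /\ y = tadd (seqc (effL Y a) s) w.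
    case: (effect_compl Ha) => [->//|[a' [Ha' [Ea _]]]].
    apply: state_le_trans Hle => //; first exact: test1_isT.
    exists (seqc (effL Y a') s); split; first by apply: isT_seqc => //; apply: isT_effL.
    by rewrite -(fw_seq_addl HF) -effL_tadd Ea.
  by rewrite E; apply: refines_tadd => //; rewrite -E; apply: test1_isT.
exists (prob s); split; first by split; [apply: prob_ge0 | apply: prob_le1].
apply: NNPP => Hne.
have [|a [b [Ha [Hb []]]]] := fw_local_discr HF Hs _ Hne.
  apply: isT_scale; first by apply: isT_prodst; apply: test1_isT.
  by split; [apply: prob_ge0 | apply: prob_le1].
rewrite -/(prodeff a b); apply: (fw_toR_inj HF).
rewrite (fw_seq_scr HF) (fw_toR_sc HF) prodeff_prodst.
(* The deterministic effect on [X] gives [m = prob s]; evaluating [prodeff (eff X) b] on [s] from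
   both sides then determines [l]. *)
have [l Hl] := HR b Hb; have [m Hm] := HL (eff X) (isT_eff X).
have Em : prob s = m by rewrite -prob_effL Hm prob_tsc prob_test1 //; lra.
have El : l = m * toR (seqc b y).
  have : toR (seqc (prodeff (eff X) b) s) = l.
    by rewrite prodeff_effR -(fw_seq_assoc HF) Hl -/(prob _) prob_tsc prob_test1 //; lra.
  by rewrite prodeff_effL -(fw_seq_assoc HF) Hm (fw_seq_scr HF) (fw_toR_sc HF) => <-.
rewrite prodeff_effR -(fw_seq_assoc HF) Hl (fw_seq_scr HF) (fw_toR_sc HF) Em El; lra.
Qed.

(** [W] carries a refinement of [seqc U x] back to one of [x], hence to a multiple of [x], and [U]
    returns it. *)
Lemma atomic_reversible A B (U : Hom A B) (W : Hom B A) (x : St A) :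
  isTest [W] -> seqc W U = tid A -> seqc U W = tid B -> atomic x -> atomic (seqc U x).
Proof.
move=> HW WU UW Ax D /(refines_seqc HW).
rewrite (fw_seq_assoc HF) WU (fw_seq_idl HF) => /Ax [l [Hl E]]; exists l; split=> //.
by rewrite -(fw_seq_scr HF) -E (fw_seq_assoc HF) UW (fw_seq_idl HF).
Qed.

Lemma atomic_cast A A' B B' (e1 : A = A') (e2 : B = B') (x : Hom A B) :
  atomic x -> atomic (castT e1 e2 x).
Proof. by destruct e1, e2. Qed.

Lemma test1_cast A A' B B' (e1 : A = A') (e2 : B = B') (x : Hom A B) :
  isTest [x] -> isTest [castT e1 e2 x].
Proof. by destruct e1, e2. Qed.

Lemma test1_seqc A B C (x : Hom B C) (y : Hom A B) :
  isTest [x] -> isTest [y] -> isTest [seqc x y].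
Proof. by move=> Hx Hy; apply: (test_seq1 Hx Hy). Qed.

Lemma test1_par A B C D (x : Hom A B) (y : Hom C D) :
  isTest [x] -> isTest [y] -> isTest [par x y].
Proof. by move=> Hx Hy; apply: (test_1par Hx Hy). Qed.

Lemma test1_prodst X Y (x : St X) (y : St Y) :
  isTest [x] -> isTest [y] -> isTest [prodst x y].
Proof. by move=> Hx Hy; apply: test1_cast; apply: test1_par. Qed.

Lemma test1_purification A B (x : St (cmp A B)) : isTest [x] -> atomic x ->
  normalized x /\ pure x.
Proof.
by move=> Hx Ax; do !split=> //; [exact: test1_isT|exact: prob_test1|exact: test1_isT].
Qed.

Lemma par_tid_effR W X Y (b : Hom Y sI) :
  Mor (par (tid W) (effR X b)) = Mor (effR (cmp W X) b).
Proof. by rewrite Mor_par !Mor_cast !Mor_par mtensA !Mor_tid mid_cmp. Qed.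

Lemma Mor_eff_cmp X Y : Mor (eff (cmp X Y)) = mtens (Mor (eff X)) (Mor (eff Y)).
Proof. by rewrite eff_cmp Mor_cast. Qed.

Lemma marg1_tens A B Y (x : St (cmp A B)) (y : St Y) (z : St (cmp A (cmp B Y))) :
  isTest [y] -> Mor z = mtens (Mor x) (Mor y) -> Mor (marg1 z) = Mor (marg1 x).
Proof.
move=> Hy Hz; rewrite /marg1 !(Mor_seqc, Mor_cast, Mor_par) Hz Mor_eff_cmp mtensA.
rewrite mtens_comp; try sysd.
by rewrite -(Mor_seqc _ y) eff_seqc // eff_sI Mor_tid mtens1.
Qed.

(** * Purifications with different purifying systems *)

Hypothesis HP : Purification T.

(* [Psi (x) Psi'] and, up to a swap of [C] with [B A], [Psi' (x) swap Psi]
   purify the same state with the same purifying system [B A C]; the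
   reversible channel relating them yields [V]. *)
Lemma purification_channel A B C (Psi : St (cmp A B)) (Psi' : St (cmp A C)) :
  isTest [Psi] -> isTest [Psi'] -> atomic Psi -> atomic Psi' ->
  marg1 Psi = marg1 Psi' ->
  exists V : Hom B C, isTest [V] /\ seqc (par (tid A) V) Psi = Psi'.
Proof.
move=> H1 H1' Ha Ha' Hm.
pose Psis := seqc (swap A B) Psi.
have Hs : isTest [Psis] := test1_seqc (fw_swap_test HF A B) H1.
have As : atomic Psis.
  by apply: (atomic_reversible (fw_swap_test HF B A)); rewrite ?(fw_swap_inv HF).
pose P1 : St (cmp A (cmp B (cmp A C))) :=
  castT eq_refl (eq_sym (cmpA A B (cmp A C))) (prodst Psi Psi').
pose s := par (tid A) (swap C (cmp B A)).
pose Q : St (cmp A (cmp C (cmp B A))) :=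
  castT eq_refl (eq_sym (cmpA A C (cmp B A))) (prodst Psi' Psis).
have e : cmp A (cmp (cmp B A) C) = cmp A (cmp B (cmp A C)) by rewrite !cmpA.
pose P2 : St (cmp A (cmp B (cmp A C))) := castT eq_refl e (seqc s Q).
have HP1 : isTest [P1] by apply: test1_cast; apply: test1_prodst.
have AP1 : atomic P1 by apply: atomic_cast; apply: prodst_atomic.
have HQ : isTest [Q] by apply: test1_cast; apply: test1_prodst.
have AQ : atomic Q by apply: atomic_cast; apply: prodst_atomic.
have Hsw : isTest [s] by apply: test1_par; [apply: fw_test_id HF _ | apply: fw_swap_test HF _ _].
have HP2 : isTest [P2] by apply: test1_cast; apply: test1_seqc.
have AP2 : atomic P2.
{
  apply: atomic_cast; apply: (@atomic_reversible _ _ _ (par (tid A) (swap (cmp B A) C))) => //.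
  - by apply: test1_par; [apply: fw_test_id HF _ | apply: fw_swap_test HF _ _].
  - by rewrite (fw_par_seq HF) (fw_swap_inv HF) (fw_seq_idl HF) (fw_par_id HF).
  - by rewrite (fw_par_seq HF) (fw_swap_inv HF) (fw_seq_idl HF) (fw_par_id HF).
}
have M1 : marg1 P1 = marg1 Psi.
  by apply: Mor_inj; apply: marg1_tens H1' _; rewrite !Mor_cast.
have M2 : marg1 P2 = marg1 Psi'.
  have <- : marg1 Q = marg1 Psi'.
    by apply: Mor_inj; apply: marg1_tens Hs _; rewrite !Mor_cast.
  have Ee : Mor (eff (cmp B (cmp A C))) = Mor (eff (cmp (cmp B A) C)) by rewrite cmpA.
  rewrite /marg1; tomor; rewrite Ee.
  rewrite mcompA; try sysd.
  rewrite -mid_tens_comp // -Mor_seqc eff_seqc //; exact: fw_swap_test HF _ _.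
have [N1 P1p] := test1_purification HP1 AP1.
have [N2 P2p] := test1_purification HP2 AP2.
have [U [[HU _] EU]] := proj2 HP _ _ _ _ N1 N2 P1p P2p (eq_trans M1 (eq_trans Hm (eq_sym M2))).
have e' : cmp B (cmp A C) = cmp (cmp B A) C by rewrite cmpA.
(* As a circuit: prepare [Psi'] beside [B], apply [U], move [C] to the front, discard [B A]. On
   [Psi] the discarded part is the padding [Psis], so [Psi'] remains. *)
pose V : Hom B C := seqc (effR C (eff (cmp B A))) (seqc (swap (cmp B A) C)
  (seqc (castT eq_refl e' U) (castT (cmpI_r B) eq_refl (par (tid B) Psi')))).
exists V; split.
  apply: test1_seqc; first exact: (test_effR C (fw_eff_test HF (cmp B A))).
  apply: test1_seqc; first exact: fw_swap_test HF _ _.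
  apply: test1_seqc; first by apply: test1_cast; apply: channel_test.
  by apply: test1_cast; apply: test1_par => //; apply: fw_test_id HF _.
have Ek : mcomp (mtens (mid A) (mtens (mid B) (Mor Psi'))) (Mor Psi) = Mor P1.
  rewrite mtensA mid_cmp -{1}(mtens1 (Mor Psi)) mtens_comp // mcomp_idl // mcomp_idr //.
  by rewrite Mor_cast Mor_cast.
have EU' : mcomp (mtens (mid A) (Mor U)) (Mor P1) = mcomp (Mor s) (Mor Q).
  by rewrite -Mor_tid -Mor_par -!Mor_seqc -EU Mor_cast.
have Es : mcomp (mtens (mid A) (Mor (swap (cmp B A) C))) (mcomp (Mor s) (Mor Q)) = Mor Q.
  rewrite mcompA; try sysd.
  by rewrite Mor_par -mid_tens_comp // -Mor_seqc (fw_swap_inv HF) Mor_tid mid_cmp mcomp_idl.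
tomor.
rewrite !mid_tens_comp; try sysd.
rewrite -!mcompA; try sysd.
rewrite Ek EU' Es mtensA mid_cmp Mor_cast Mor_cast Mor_par mtens_comp // mcomp_idl //.
by rewrite -Mor_seqc eff_seqc // eff_sI Mor_tid mtens1.
Qed.

Lemma test_prob A (t : list (St A)) : isTest t -> fold_right Rplus 0 (map (@prob A) t) = 1.
Proof.
move=> Ht; have := fw_prob_sum HF (test_seq1 (fw_eff_test HF A) Ht).
by rewrite map_map.
Qed.

(** Up to casts this swap is a deterministic effect of the trivial system, hence the identity by
    causality. *)
Lemma swap_sI : Mor (swap (@sI T) sI) = mid sI.
Proof.
rewrite -(Mor_cast (cmpI_r sI) (cmpI_r sI)) -Mor_tid -eff_sI; congr Mor.
by apply: (fw_eff_unique HF); apply: test1_cast; apply: fw_swap_test HF _ _.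
Qed.

Lemma prodeff_swap X Y (a : Hom X sI) (b : Hom Y sI) :
  seqc (prodeff a b) (swap Y X) = prodeff b a.
Proof.
tomor; rewrite -Mor_par -Mor_seqc -(fw_swap_nat HF) Mor_seqc swap_sI mcomp_idl //=.
by rewrite cmpI_r.
Qed.

Lemma marg1_swap X Y (x : St (cmp X Y)) : isT x -> marg1 (seqc (swap X Y) x) = marg2 x.
Proof.
move=> Hx; rewrite /marg1 /marg2 -/(effR Y (eff X)) -/(effL Y (eff X)).
have Hs := test1_isT (fw_swap_test HF X Y).
apply: (fw_state_sep HF).
- by apply: isT_seqc; [apply: isT_effR; apply: isT_eff | apply: isT_seqc].
- by apply: isT_seqc => //; apply: isT_effL; apply: isT_eff.
- move=> a _.
  by rewrite !(fw_seq_assoc HF) -prodeff_effR prodeff_swap prodeff_effL.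
Qed.

(** Each step adds a perfectly readable flag: [r1] marks the indices up to [n], which [c] then tells
    apart, and [r2] marks index [n + 1], where any normalised [phi] will do. *)
Lemma distinguishable_states n : exists C (phi : nat -> St C) (c : nat -> Hom C sI),
  isTest (map c (seq 0 (S n))) /\ (forall i, isTest [phi i]) /\
  forall i j, (i <= n)%nat -> (j <= n)%nat ->
    toR (seqc (c i) (phi j)) = if Nat.eqb i j then 1 else 0.
Proof.
have [A [r1 [r2 [a1 [a2 [/normalized_test H1 [/normalized_test H2 [Ha [H11 [H22 [H12 H21]]]]]]]]]]] :=
  fw_perf_dist HF.
elim: n => [|n [C [phi [c [Hc [Hphi Hd]]]]]].
  exists sI, (fun _ => tid sI), (fun _ => tid sI); split; first exact: fw_test_id HF _.
  split=> [_|i j Hi Hj]; first exact: fw_test_id HF _.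
  by rewrite (_ : i = j) ?Nat.eqb_refl; [lia | rewrite (fw_seq_idl HF) (fw_toR_id HF)].
exists (cmp C A), (fun j => if Nat.leb j n then prodst (phi j) r1 else prodst (phi j) r2),
  (fun i => if Nat.leb i n then seqc (c i) (effR C a1) else seqc (eff C) (effR C a2)).
split; last split.
- have := @fw_test_cond _ HF _ _ _ _ [map c (seq 0 (S n)); [eff C]] (test_effR C Ha) eq_refl.
  move=> /(_ (Forall_cons _ Hc (Forall_cons _ (fw_eff_test HF C) (Forall_nil _)))).
  rewrite (seq_S (S n) 0) map_app Nat.add_0_l.
  have -> : map (fun i => if Nat.leb i n then seqc (c i) (effR C a1) else seqc (eff C) (effR C a2))
      (seq 0 (S n)) = map (fun D => seqc D (effR C a1)) (map c (seq 0 (S n))).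
    rewrite map_map; apply: map_ext_in => i /in_seq [_ Hi].
    by rewrite (proj2 (Nat.leb_le i n)) //; lia.
  have -> : map (fun i => if Nat.leb i n then seqc (c i) (effR C a1) else seqc (eff C) (effR C a2))
      [S n] = [seqc (eff C) (effR C a2)].
    by cbn [map]; rewrite (proj2 (Nat.leb_gt (S n) n)) //; lia.
  by move: (map c _) => L.
- by move=> i; case: Nat.leb; apply: test1_prodst.
- have E x a k r : toR (seqc (seqc x (effR C a)) (prodst (phi k) r)) =
    toR (seqc a r) * toR (seqc x (phi k)).
    by rewrite -(fw_seq_assoc HF) effR_prodst (fw_seq_scr HF) (fw_toR_sc HF).
  move=> i j Hi Hj.
  case: (Nat.leb_spec i n) => Hin; case: (Nat.leb_spec j n) => Hjn; rewrite E.
  + by rewrite H11 Hd //; lra.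
  + by rewrite H12 (proj2 (Nat.eqb_neq i j)); [lia | lra].
  + by rewrite H21 (proj2 (Nat.eqb_neq i j)); [lia | lra].
  + rewrite H22 (_ : i = j) ?Nat.eqb_refl; first lia.
    by rewrite -/(prob _) (prob_test1 (Hphi j)); lra.
Qed.

Lemma map_nth_seq0 X (d : X) (l : list X) : map (fun i => nth i l d) (seq 0 (length l)) = l.
Proof. by elim: l => //= x l IH; rewrite -seq_shift map_map /= IH. Qed.

Lemma tsum_kronecker A B (f : nat -> Hom A B) i l : NoDup l -> In i l ->
  tsum (map (fun j => tsc (if Nat.eqb i j then 1 else 0) (f j)) l) = f i.
Proof.
have Z l' : ~ In i l' -> tsum (map (fun j => tsc (if Nat.eqb i j then 1 else 0) (f j)) l') = tz.
  elim: l' => //= j l' IH Hn; rewrite IH; first by tauto.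
  by rewrite (proj2 (Nat.eqb_neq i j)) ?tsc0 ?(fw_add_0 HF) //; intuition.
move=> Hl Hi; have [l1 [l2 E]] := in_split _ _ Hi.
have := NoDup_remove_2 l1 l2 i; rewrite -E => /(_ Hl) Hn.
rewrite E map_app tsum_app /= !Z; try by move=> H; apply: Hn; apply/in_or_app; tauto.
by rewrite Nat.eqb_refl (fw_sc_1 HF) tadd_0l (fw_add_0 HF).
Qed.

Lemma effR_eff_cmp W X Y : Mor (effR W (eff (cmp X Y))) =
  mcomp (Mor (effR W (eff X))) (Mor (effR (cmp W X) (eff Y))).
Proof.
rewrite !Mor_cast !Mor_par Mor_eff_cmp mtensA !Mor_tid.
rewrite -(mtens1 (mtens (mid W) (Mor (eff X)))) mtens_comp //.
by rewrite mtens1 mcomp_idr // mcomp_idl.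
Qed.

(** * The correspondence between transformations and states *)

Section Choi.
Variables (A At : Sys T) (Psi : St (cmp A At)).
Hypotheses (Psi_test : isTest [Psi]) (Psi_atomic : atomic Psi) (Psi_faithful : dynFaithful Psi).

(** Uniqueness of purification yields maps on the right factor, while [choi] acts on the left one;
    conjugating with swaps reconciles the two. *)
Lemma choi_swap B (x : Hom A B) :
  choi Psi x = seqc (swap At B) (seqc (par (tid At) x) (seqc (swap A At) Psi)).
Proof.
rewrite (fw_seq_assoc HF) (fw_swap_nat HF) -(fw_seq_assoc HF) (fw_seq_assoc HF (swap At A)).
by rewrite (fw_swap_inv HF) (fw_seq_idl HF).
Qed.

Lemma test_choi B (t : list (Hom A B)) : isTest t -> isTest (map (choi Psi) t).
Proof.
move=> Ht; have := test_1seq Psi_test (test_par1 Ht (fw_test_id HF At)).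
by rewrite map_map.
Qed.

Lemma isT_choi B (x : Hom A B) : isT x -> isT (choi Psi x).
Proof.
by move=> Hx; apply: isT_seqc; [apply: isT_par => //; apply: isT_tid | apply: test1_isT].
Qed.

Lemma choi_tsum B (t : list (Hom A B)) : choi Psi (tsum t) = tsum (map (choi Psi) t).
Proof. by rewrite /choi tsum_par tsum_seqc map_map. Qed.

Lemma choi_tsc B p (x : Hom A B) : choi Psi (tsc p x) = tsc p (choi Psi x).
Proof. by rewrite /choi (fw_par_scl HF) (fw_seq_scl HF). Qed.

Lemma marg2_tsum B (l : list (St (cmp B At))) : tsum (map marg2 l) = marg2 (tsum l).
Proof. by rewrite /marg2 seqc_tsum. Qed.

Lemma marg2_choi_test B (x : Hom A B) : isTest [x] -> marg2 (choi Psi x) = marg2 Psi.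
Proof.
move=> /eff_seqc Hx; rewrite /marg2 /choi; tomor.
rewrite mcompA; try sysd.
by rewrite mtens_comp // mcomp_idl // -Mor_seqc Hx.
Qed.

Lemma test_neq_nil B (t : list (Hom A B)) : isTest t -> t <> [].
Proof. by move=> /test_choi /prep_neq_nil H E; apply: H; rewrite E. Qed.

Lemma marg2_choi B (t : list (Hom A B)) : isTest t ->
  tsum (map marg2 (map (choi Psi) t)) = marg2 Psi.
Proof.
move=> Ht; rewrite marg2_tsum -choi_tsum; apply: marg2_choi_test; apply: test_tsum => //.
exact: test_neq_nil Ht.
Qed.

Lemma map_choi_inj B (t u : list (Hom A B)) :
  (forall x, In x t -> isT x) -> (forall x, In x u -> isT x) ->
  map (choi Psi) t = map (choi Psi) u -> t = u.
Proof.
elim: t u => [|x t IH] [|y u] //= Ht Hu [E1 E2]; congr cons.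
  by apply: (Psi_faithful _ _ E1); [apply: Ht | apply: Hu]; left.
by apply: IH => // z Hz; [apply: Ht | apply: Hu]; right.
Qed.

Lemma choi_surjective B (r : list (St (cmp B At))) :
  isTest r -> tsum (map marg2 r) = marg2 Psi ->
  exists t : list (Hom A B), isTest t /\ map (choi Psi) t = r.
Proof.
move=> Hr Hm.
have [n Hn] : exists n, length r = S n.
  by case: r Hr {Hm} => [/prep_neq_nil//|x r] _; exists (length r).
have [C [phi [c [Hc [Hphi Hd]]]]] := distinguishable_states n.
(* [At] goes first because the purified system is the left factor. The default [tz] matters only
   beyond index [n], outside the list. *)
pose rs i := seqc (swap B At) (nth i r tz).
have Hri i : (i <= n)%nat -> isT (nth i r tz).
  by move=> Hi; apply: (test_isT Hr); apply: nth_In; lia.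
have Hrs i : (i <= n)%nat -> isT (rs i).
  by move=> /Hri Hi; apply: isT_seqc => //; apply: test1_isT; apply: fw_swap_test HF _ _.
pose l := map (fun i => prodst (rs i) (phi i)) (seq 0 (S n)).
have Hl : isTest l.
  apply: preparation_test.
    apply/Forall_map; apply/Forall_forall => i /in_seq [_ Hi].
    by apply: isT_prodst; [apply: Hrs; lia | apply: test1_isT].
  rewrite -(test_prob Hr) -{1}(map_nth_seq0 tz r) Hn !map_map; congr fold_right.
  apply: map_ext => i; rewrite prob_prodst (prob_test1 (Hphi i)) Rmult_1_r.
  by rewrite /prob (fw_seq_assoc HF) eff_seqc //; apply: fw_swap_test HF _ _.
pose sigma := tsum l.
have Hsigma : isTest [sigma] by apply: test_tsum => //; apply: prep_neq_nil.
(* This serves twice: [a = eff C] forgets the label and gives the sum of all [rs i], while [a = c i]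
   selects [rs i]. *)
have effR_sigma (a : Hom C sI) :
    seqc (effR (cmp At B) a) sigma = tsum (map (fun i => tsc (toR (seqc a (phi i))) (rs i)) (seq 0 (S n))).
  by rewrite /sigma seqc_tsum map_map; congr tsum; apply: map_ext => i; apply: effR_prodst.
have [D [P [/normalized_test HPt [[_ AP] HPm]]]] := proj1 HP _ _ (proj2 (normalized_test _) Hsigma).
have e : cmp (cmp (cmp At B) C) D = cmp At (cmp (cmp B C) D) by rewrite !cmpA.
pose P' : St (cmp At (cmp (cmp B C) D)) := castT eq_refl e P.
pose Psis := seqc (swap A At) Psi.
have effR_P (a : Hom C sI) : mcomp (mcomp (Mor (effR (cmp At B) a))
    (Mor (effR (cmp At (cmp B C)) (eff D)))) (Mor P') = Mor (seqc (effR (cmp At B) a) sigma).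
  have -> : Mor (effR (cmp At (cmp B C)) (eff D)) = Mor (effR (cmp (cmp At B) C) (eff D)).
    by rewrite cmpA.
  rewrite -HPm !Mor_seqc !Mor_cast -mcompA; sysd.
(* Discarding [D] recovers [sigma], discarding the label sums the [rs i], and discarding [B] leaves
   the sum of marginals, fixed by [Hm]. *)
have Hmarg : marg1 Psis = marg1 P'.
  rewrite marg1_swap; first exact: test1_isT.
  rewrite -Hm; apply: Mor_inj.
  rewrite [in RHS]Mor_seqc -/(effR At (eff (cmp (cmp B C) D))) !effR_eff_cmp.
  have := effR_P (eff C); rewrite -!mcompA; try sysd.
  move=> ->; rewrite -Mor_seqc; congr Mor.
  rewrite effR_sigma seqc_tsum map_map -{1}(map_nth_seq0 tz r) Hn map_map; congr tsum.
  apply: map_ext_in => i /in_seq [_ Hi].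
  rewrite -/(prob _) (prob_test1 (Hphi i)) (fw_sc_1 HF) -marg1_swap //.
  by apply: Hri; lia.
have [V [HV EV]] : exists V : Hom A (cmp (cmp B C) D), isTest [V] /\ seqc (par (tid At) V) Psis = P'.
{ apply: purification_channel => //.
  - by apply: test1_seqc => //; apply: fw_swap_test HF _ _.
  - exact: test1_cast.
  - by apply: (atomic_reversible (fw_swap_test HF At A)); rewrite ?(fw_swap_inv HF).
  - exact: atomic_cast. }
pose t i := seqc (effR B (c i)) (seqc (effR (cmp B C) (eff D)) V).
have Et i : (i <= n)%nat -> choi Psi (t i) = nth i r tz.
  move=> Hi; rewrite choi_swap.
  have -> : seqc (par (tid At) (t i)) Psis = rs i.
    transitivity (seqc (effR (cmp At B) (c i)) sigma).
      apply: Mor_inj; rewrite -effR_P -EV !Mor_seqc Mor_par Mor_tid !Mor_seqc.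
      rewrite !mid_tens_comp; try sysd.
      rewrite -Mor_tid -!Mor_par !par_tid_effR -!mcompA; sysd.
    rewrite effR_sigma -(@tsum_kronecker _ _ rs i (seq 0 (S n))); first exact: seq_NoDup.
      by apply/in_seq; lia.
    congr tsum; apply: map_ext_in => j /in_seq [_ Hj].
    by rewrite Hd //; lia.
  by rewrite /rs (fw_seq_assoc HF) (fw_swap_inv HF) (fw_seq_idl HF).
exists (map t (seq 0 (S n))); split.
  have Hw : isTest [seqc (effR (cmp B C) (eff D)) V].
    by apply: test1_seqc => //; apply: (test_effR _ (fw_eff_test HF D)).
  by have := test_1seq Hw (test_effR B Hc); rewrite !map_map.
rewrite map_map -[RHS](map_nth_seq0 tz r) Hn; apply: map_ext_in => i /in_seq [_ Hi].
by apply: Et; lia.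
Qed.

Lemma choi_tests_bij B : bij_on (fun t : list (Hom A B) => isTest t)
  (fun r : list (St (cmp B At)) => isTest r /\ tsum (map marg2 r) = marg2 Psi)
  (map (choi Psi)).
Proof.
split; last split.
- by move=> t Ht; split; [apply: test_choi | apply: marg2_choi].
- by move=> t u Ht Hu; apply: map_choi_inj => x; apply: test_isT.
- by move=> r [Hr Hm]; apply: choi_surjective.
Qed.

Lemma choi_atomic B (C : Hom A B) : isT C -> (atomic C <-> pure (choi Psi C)).
Proof.
move=> HC; split=> [AC|[_ AR] D HD]; last first.
  have HDT := refines_isT HD.
  have [l [Hl E]] : exists l, 0 <= l <= 1 /\ choi Psi D = tsc l (choi Psi C).
    apply: AR; case/refinesP: HD => [l1 [l2 [Ht ->]]]; apply/refinesP.
    exists (map (choi Psi) l1), (map (choi Psi) l2); split; last exact: choi_tsum.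
    by have := test_choi Ht; rewrite /= map_app.
  exists l; split=> //; apply: Psi_faithful => //; first exact: isT_scale.
  by rewrite -/(choi Psi D) E -choi_tsc.
split=> [|D /refinesP [l1 [l2 [HD ED]]]]; first exact: isT_choi.
have [ks Hks] := isT_test HC.
have HR := test_choi Hks.
have HDT x : In x (D :: l1) -> isT x.
  by move=> Hx; apply: (test_isT HD); rewrite app_comm_cons; apply/in_or_app; left.
(* The outcomes [l2] have an uncontrolled marginal. They are replaced by the images of the other
   outcomes [ks] of a test containing [C], which makes the total marginal correct. *)
have [||t [Ht Et]] := @choi_surjective B ((D :: l1) ++ map (choi Psi) ks).
- apply: preparation_test.
    apply/Forall_app; split; first by apply/Forall_forall.
    by apply/Forall_forall => x Hx; apply: (test_isT HR); right.
  by rewrite -(test_prob HR) -!prob_tsum tsum_app -ED.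
- by rewrite map_app tsum_app marg2_tsum -ED -(marg2_choi Hks).
- have [t1 [t2 [E [E1 E2]]]] := map_eq_app _ _ _ _ Et.
  case: t1 E E1 => // F t1 E [EF E1].
  have HF' : isTest (F :: t1 ++ t2) by rewrite E in Ht.
  (* The lifted block has the same image as [C], so by faithfulness it sums to [C] and [F] refines
     [C]. *)
  have EC : C = tsum (F :: t1).
    apply: Psi_faithful => //; first by apply: (test_isT (test_tsum_app HF')); left.
    by rewrite -!/(choi Psi _) choi_tsum ED /= EF E1.
  have [l [Hl EF']] : exists l, 0 <= l <= 1 /\ F = tsc l C.
    by apply: AC; apply/refinesP; exists t1, t2.
  by exists l; split=> //; rewrite -EF EF' choi_tsc.
Qed.

Lemma choi_bij B : bij_on (fun C : Hom A B => isT C)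
  (fun R : St (cmp B At) => isT R /\ refines (marg2 R) (marg2 Psi)) (choi Psi).
Proof.
split; last split.
- move=> C HC; split; first exact: isT_choi.
  have [ks Hks] := isT_test HC; apply/refinesP.
  exists (map marg2 (map (choi Psi) ks)), []; split; last by rewrite -(marg2_choi Hks).
  rewrite app_nil_r.
  exact: (test_seq1 (test_effL At (fw_eff_test HF B)) (test_choi Hks)).
- by move=> C D HC HD; apply: Psi_faithful.
- move=> R [HR /refinesP [l1 [l2 [Hl El]]]].
  (* Some normalised state of [B] is needed, and the marginal of [R] on [B] provides one. Since
     [prodst b x] has marginal [x], the products with [l1] supply exactly what [marg2 R] lacks. *)
  have [b [Hb _]] := deterministic_part (isT_seqc (isT_effR B (isT_eff At)) HR).
  have [||t [Ht Et]] := @choi_surjective B (R :: map (prodst b) l1).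
  + apply: preparation_test.
      constructor=> //; apply/Forall_map; apply/Forall_forall => x Hx.
      apply: isT_prodst; first exact: test1_isT.
      by apply: (test_isT Hl); right; apply/in_or_app; left.
    have -> : map (@prob _) (R :: map (prodst b) l1) = map (@prob _) (marg2 R :: l1).
      rewrite /= map_map; congr cons; first by rewrite -prob_effL.
      by apply: map_ext => x; rewrite prob_prodst (prob_test1 Hb); lra.
    by rewrite -prob_tsum -El prob_effL prob_test1.
  + rewrite El /= map_map; congr tadd; congr tsum; rewrite -[RHS]map_id; apply: map_ext => x.
    by rewrite /marg2 -/(effL At (eff B)) effL_prodst -/(prob b) (prob_test1 Hb) (fw_sc_1 HF).
  + case: t Ht Et => // C t Ht [<- _]; exists C; split=> //.
    by apply: (test_isT Ht); left.
Qed.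

End Choi.
End Theory.

Theorem mainTheorem11 :
  forall (T : OPTdata), Framework T -> Purification T ->
  forall (A At : Sys T) (Psi : Tr T sI (cmp A At)),
    normalized Psi -> pure Psi -> dynFaithful Psi ->
    forall B : Sys T,
      (* (1) tests A -> B  <->  preparation-tests of B At summing to omega~ *)
      bij_on (fun t : list (Tr T A B) => isTest t)
             (fun r : list (Tr T sI (cmp B At)) =>
                isTest r /\ tsum (map marg2 r) = marg2 Psi)
             (map (choi Psi))
      (* (2) atomicity <-> purity *)
      /\ (forall C : Tr T A B, isT C -> (atomic C <-> pure (choi Psi C)))
      (* (3) transformations A -> B <-> states R of B At with marginal in D_omega~ *)
      /\ bij_on (fun C : Tr T A B => isT C)
                (fun R : Tr T sI (cmp B At) => isT R /\ refines (marg2 R) (marg2 Psi))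
                (choi Psi).
Proof.
move=> T HF HP A At Psi /(normalized_test HF) Ht [_ Ha] Hf B.
split; first exact: choi_tests_bij.
split; last exact: choi_bij.
by move=> C; apply: choi_atomic.
Qed.
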